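(* For all integers $p,s,q\ge 0$ and all $z\in\mathbb{C}$, $$H_{p+s,q}(z,\overline{z})=\left(\sqrt{2}\right)^{p+s-q}q!\sum_{k=0}^{q}\frac{H_{s,k}\left(\frac{z}{\sqrt{2}},\frac{\overline{z}}{\sqrt{2}}\right)}{k!}\,\frac{H_{p,q-k}\left(\frac{z}{\sqrt{2}},\frac{\overline{z}}{\sqrt{2}}\right)}{(q-k)!}.$$
   Context: For $z=x+iy\in\mathbb{C}$, $\partial_z=\frac12\left(\frac{\partial}{\partial x}-i\frac{\partial}{\partial y}\right)$ and $\partial_{\overline{z}}=\frac12\left(\frac{\partial}{\partial x}+i\frac{\partial}{\partial y}\right)$. The complex Hermite polynomials are, for integers $p,q\ge 0$, $$H_{p,q}(z,\overline{z})=(-1)^{p+q}e^{z\overline{z}}\,\partial_{\overline{z}}^{p}\partial_z^{q}\left(e^{-z\overline{z}}\right).$$ The notation $H_{p,q}(\lambda z,\lambda\overline{z})$ with $\lambda$ real means the value of $H_{p,q}$ at the point $\lambda z$. *)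

(* Defs.v *)
From Stdlib Require Import Reals ZArith.
From Coquelicot Require Export Coquelicot.

Local Open Scope C_scope.

Definition Cexp (z : C) : C :=
  (exp (Re z) * cos (Im z), exp (Re z) * sin (Im z))%R.

(* [Derive] is total; for functions whose real and imaginary parts are smooth
   in (x, y) (the only ones used here) these are the genuine partial
   derivatives. *)
Definition partial_x (f : C -> C) (z : C) : C :=
  (Derive (fun x : R => Re (f (x, Im z))) (Re z),
   Derive (fun x : R => Im (f (x, Im z))) (Re z)).

Definition partial_y (f : C -> C) (z : C) : C :=
  (Derive (fun y : R => Re (f (Re z, y))) (Im z),
   Derive (fun y : R => Im (f (Re z, y))) (Im z)).

Definition partial_z (f : C -> C) (z : C) : C :=
  RtoC (1 / 2)%R * (partial_x f z - Ci * partial_y f z).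

Definition partial_zbar (f : C -> C) (z : C) : C :=
  RtoC (1 / 2)%R * (partial_x f z + Ci * partial_y f z).

(* [complexHermite p q z] is H_{p,q}(z, conj z): the second argument of the
   usual notation is always the conjugate of the first. *)
Definition complexHermite (p q : nat) (z : C) : C :=
  (RtoC (-1)%R) ^ (p + q) * Cexp (z * Cconj z) *
  Nat.iter p partial_zbar
    (Nat.iter q partial_z (fun w : C => Cexp (- (w * Cconj w)))) z.

(* Main.v *)
Require Import Defs.
From Stdlib Require Import Reals ZArith Lra Lia FunctionalExtensionality.
From Coquelicot Require Import Coquelicot.

(** For fixed [p], the generating function [sum_q H_{p,q}(z,w) v^q / q!] is
    [(z - v)^p e^{v w}].  Hence, as sequences in [q], the numbers
    [H_{p,q}(z,w) / q!] arise from [w^q / q!] by applying [p] times the operator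
    "multiply by [z - v]".  Convolution of sequences is linear over this
    operator, so convolving the sequences for [s] and [p] at
    [(z / sqrt 2, w / sqrt 2)] gives the coefficients of
    [(z / sqrt 2 - v)^(p + s) e^{sqrt 2 v w}]; the substitution
    [v -> v / sqrt 2] turns this into the sequence for [p + s] at [(z, w)]. *)

Local Open Scope C_scope.

(** * Coefficient sequences and their convolution *)

Definition shift (a : nat -> C) (k : nat) : C :=
  match k with O => 0 | S j => a j end.

Definition mul_sub (z : C) (a : nat -> C) (k : nat) : C := z * a k - shift a k.

Definition exp_coeff (w : C) (k : nat) : C := w ^ k / RtoC (INR (fact k)).

(** [w] stays independent of [z], so that the two can be rescaled separately. *)
Definition hermite_coeff (p : nat) (z w : C) : nat -> C :=
  Nat.iter p (mul_sub z) (exp_coeff w).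

Definition conv (a b : nat -> C) (n : nat) : C :=
  sum_n (fun k => a k * b (n - k)%nat) n.

Lemma fact_C_neq_0 (n : nat) : RtoC (INR (fact n)) <> 0.
Proof.
  intros H; apply RtoC_inj in H; exact (INR_fact_neq_0 n H).
Qed.

(** In series form [(v A) B = v (A B)]: the term at [k = 0] vanishes and the others are reindexed by
    one. *)
Lemma conv_shift_l (a b : nat -> C) (n : nat) :
  conv (shift a) b n = shift (conv a b) n.
Proof.
  destruct n as [|n]; unfold conv; simpl.
  - rewrite sum_O; simpl; ring.
  - unfold sum_n; rewrite sum_Sn_m by lia.
    rewrite <- sum_n_m_S; simpl.
    change plus with Cplus; ring.
Qed.

Lemma conv_shift_r (a b : nat -> C) (n : nat) :
  conv a (shift b) n = shift (conv a b) n.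
Proof.
  destruct n as [|n]; unfold conv.
  - rewrite sum_O; simpl; ring.
  - rewrite sum_Sn, Nat.sub_diag; cbn [shift].
    change plus with Cplus.
    rewrite (sum_n_ext_loc _ (fun k => a k * b (n - k)%nat)).
    + ring.
    + intros k Hk; rewrite Nat.sub_succ_l by exact Hk; reflexivity.
Qed.

Lemma sum_n_C_ext (u v : nat -> C) (n : nat) :
  (forall k, (k <= n)%nat -> u k = v k) -> sum_n u n = sum_n v n.
Proof. apply sum_n_ext_loc. Qed.

Lemma sum_n_C_linear (c : C) (u v : nat -> C) (n : nat) :
  c * sum_n u n - sum_n v n = sum_n (fun k => c * u k - v k) n.
Proof.
  induction n as [|n IH].
  - now rewrite !sum_O.
  - rewrite !sum_Sn, <- IH; change plus with Cplus; ring.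
Qed.

Lemma conv_mul_sub_l (z : C) (a b : nat -> C) :
  conv (mul_sub z a) b = mul_sub z (conv a b).
Proof.
  apply functional_extensionality; intros n.
  unfold mul_sub at 2; rewrite <- conv_shift_l; unfold conv.
  rewrite sum_n_C_linear; apply sum_n_C_ext; intros k _; unfold mul_sub; ring.
Qed.

Lemma conv_mul_sub_r (z : C) (a b : nat -> C) :
  conv a (mul_sub z b) = mul_sub z (conv a b).
Proof.
  apply functional_extensionality; intros n.
  unfold mul_sub at 2; rewrite <- conv_shift_r; unfold conv.
  rewrite sum_n_C_linear; apply sum_n_C_ext; intros k _; unfold mul_sub; ring.
Qed.

(** Coefficient form of [e^{vw} e^{vw} = e^{2vw}]; it reduces to the binomial coefficients of [n]
    having sum [2^n]. *)
Lemma conv_exp_coeff (w : C) :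
  conv (exp_coeff w) (exp_coeff w) = exp_coeff (RtoC 2 * w).
Proof.
  apply functional_extensionality; intros n.
  assert (H : RtoC (2 ^ n) =
              sum_n (fun k => RtoC (Binomial.C n k)) n).
  { replace 2%R with (1 + 1)%R by ring.
    rewrite binomial, <- sum_n_Reals.
    transitivity (RtoC (sum_n (Binomial.C n) n)).
    - f_equal; apply sum_n_ext; intros k; now rewrite !pow1, !Rmult_1_r.
    (* Only the upper limits are generalized; the row [n] of the binomial coefficients stays fixed
       during the induction. *)
    - generalize n at 2 4; intros m; induction m as [|m IH].
      + now rewrite !sum_O.
      + rewrite !sum_Sn, <- IH; apply RtoC_plus. }
  unfold exp_coeff at 3.
  rewrite Cpow_mult_l, <- RtoC_pow, H.
  unfold conv.
  transitivity (w ^ n / RtoC (INR (fact n)) *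
    sum_n (fun k => RtoC (Binomial.C n k)) n); [|unfold Cdiv; ring].
  etransitivity; [|exact (sum_n_mult_l (K := C_Ring) (w ^ n / RtoC (INR (fact n)))
    (fun k => RtoC (Binomial.C n k)) n)].
  apply sum_n_C_ext; intros k Hk; change mult with Cmult.
  unfold exp_coeff, Binomial.C.
  rewrite RtoC_div by (apply Rmult_integral_contrapositive; split;
    apply INR_fact_neq_0).
  rewrite RtoC_mult.
  replace (w ^ n) with (w ^ k * w ^ (n - k))
    by (rewrite <- Cpow_add_r; f_equal; lia).
  field; repeat split; apply fact_C_neq_0.
Qed.

(** The factors [z - v] are pulled out of either side one at a time, until only the product of the
    two exponentials remains. *)
Lemma conv_hermite_coeff (s p : nat) (z w : C) :
  conv (hermite_coeff s z w) (hermite_coeff p z w) =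
  hermite_coeff (p + s) z (RtoC 2 * w).
Proof.
  unfold hermite_coeff; induction p as [|p IH]; simpl.
  - induction s as [|s IH]; simpl.
    + apply conv_exp_coeff.
    + now rewrite conv_mul_sub_l, IH.
  - now rewrite conv_mul_sub_r, IH.
Qed.

(** With [u = v / r], [(z - v)^n e^{vw} = r^n (z/r - u)^n e^{u r w}], and [u^k] contributes
    [v^k / r^k]. *)
Lemma hermite_coeff_scale (n k : nat) (r z w : C) : r <> 0 ->
  hermite_coeff n z w k =
  r ^ n / r ^ k * hermite_coeff n (z / r) (r * w) k.
Proof.
  intros Hr; revert k; induction n as [|n IH]; intros k.
  - unfold hermite_coeff; simpl; unfold exp_coeff.
    rewrite Cpow_mult_l; field; split; [apply fact_C_neq_0|].
    now apply Cpow_nz.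
  - change (mul_sub z (hermite_coeff n z w) k =
      r ^ S n / r ^ k * mul_sub (z / r) (hermite_coeff n (z / r) (r * w)) k).
    unfold mul_sub; destruct k as [|k]; simpl shift; rewrite !IH; simpl Cpow.
    + field; exact Hr.
    + field; split; [exact Hr | now apply Cpow_nz].
Qed.

(** * Wirtinger derivatives *)

(** Componentwise, to match [partial_x] and [partial_y]; unlike the total [Derive], it also asserts
    differentiability. *)
Definition is_curve_derive (f : R -> C) (t : R) (l : C) : Prop :=
  is_derive (fun u : R => Re (f u)) t (Re l) /\
  is_derive (fun u : R => Im (f u)) t (Im l).

Lemma is_curve_derive_const (c : C) (t : R) : is_curve_derive (fun _ => c) t 0.
Proof. split; apply is_derive_Reals, derivable_pt_lim_const. Qed.

Lemma is_curve_derive_minus (f g : R -> C) (t : R) (l m : C) :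
  is_curve_derive f t l -> is_curve_derive g t m ->
  is_curve_derive (fun u => f u - g u) t (l - m).
Proof.
  intros [F1 F2] [G1 G2]; split.
  - exact (is_derive_minus _ _ t _ _ F1 G1).
  - exact (is_derive_minus _ _ t _ _ F2 G2).
Qed.

Lemma is_curve_derive_mult (f g : R -> C) (t : R) (l m : C) :
  is_curve_derive f t l -> is_curve_derive g t m ->
  is_curve_derive (fun u => f u * g u) t (l * g t + f t * m).
Proof.
  intros [F1 F2] [G1 G2]; split; apply is_derive_Reals;
  apply is_derive_Reals in F1; apply is_derive_Reals in F2;
  apply is_derive_Reals in G1; apply is_derive_Reals in G2; simpl.
  - replace (_ + _)%R with
      ((Re l * Re (g t) + Re (f t) * Re m) - (Im l * Im (g t) + Im (f t) * Im m))%R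
      by (unfold Re, Im; ring).
    exact (derivable_pt_lim_minus _ _ t _ _
      (derivable_pt_lim_mult _ _ t _ _ F1 G1)
      (derivable_pt_lim_mult _ _ t _ _ F2 G2)).
  - replace (_ + _)%R with
      ((Re l * Im (g t) + Re (f t) * Im m) + (Im l * Re (g t) + Im (f t) * Re m))%R
      by (unfold Re, Im; ring).
    exact (derivable_pt_lim_plus _ _ t _ _
      (derivable_pt_lim_mult _ _ t _ _ F1 G2)
      (derivable_pt_lim_mult _ _ t _ _ F2 G1)).
Qed.

(** [a] and [b] are the values of [partial_z f z] and [partial_zbar f z]; the
    partial derivatives in [x] and [y] are then [a + b] and [i (a - b)]. *)
Definition is_wirtinger (f : C -> C) (z a b : C) : Prop :=
  is_curve_derive (fun x => f (x, Im z)) (Re z) (a + b) /\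
  is_curve_derive (fun y => f (Re z, y)) (Im z) (Ci * (a - b)).

(** With [X = a + b] and [Y = i (a - b)], one has [X - i Y = 2 a] and [X + i Y = 2 b]. *)
Lemma is_wirtinger_partial (f : C -> C) (z a b : C) :
  is_wirtinger f z a b -> partial_z f z = a /\ partial_zbar f z = b.
Proof.
  intros [[X1 X2] [Y1 Y2]].
  unfold partial_z, partial_zbar, partial_x, partial_y.
  rewrite (is_derive_unique _ _ _ X1), (is_derive_unique _ _ _ X2),
    (is_derive_unique _ _ _ Y1), (is_derive_unique _ _ _ Y2).
  destruct a as [a1 a2], b as [b1 b2].
  split; apply injective_projections; simpl; field.
Qed.

Lemma is_wirtinger_const (c z : C) : is_wirtinger (fun _ => c) z 0 0.
Proof.
  split.
  - replace (0 + 0) with (RtoC 0) by ring; apply is_curve_derive_const.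
  - replace (Ci * (0 - 0)) with (RtoC 0) by ring; apply is_curve_derive_const.
Qed.

Lemma is_wirtinger_id (z : C) : is_wirtinger (fun w => w) z 1 0.
Proof.
  split; split; simpl; auto_derive; trivial; ring.
Qed.

Lemma is_wirtinger_conj (z : C) : is_wirtinger Cconj z 0 1.
Proof.
  split; split; simpl; auto_derive; trivial; ring.
Qed.

Lemma is_wirtinger_minus (f g : C -> C) (z a b c d : C) :
  is_wirtinger f z a b -> is_wirtinger g z c d ->
  is_wirtinger (fun w => f w - g w) z (a - c) (b - d).
Proof.
  intros [F1 F2] [G1 G2]; split.
  - replace (_ + _) with ((a + b) - (c + d)) by ring.
    exact (is_curve_derive_minus _ _ _ _ _ F1 G1).
  - replace (Ci * _) with (Ci * (a - b) - Ci * (c - d)) by ring.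
    exact (is_curve_derive_minus _ _ _ _ _ F2 G2).
Qed.

Lemma is_wirtinger_mult (f g : C -> C) (z a b c d : C) :
  is_wirtinger f z a b -> is_wirtinger g z c d ->
  is_wirtinger (fun w => f w * g w) z (a * g z + f z * c) (b * g z + f z * d).
Proof.
  (* Once [z] is a pair, both coordinate curves pass through [z] by computation. *)
  destruct z as [x y]; intros [F1 F2] [G1 G2]; split.
  - replace (_ + _) with ((a + b) * g (x, y) + f (x, y) * (c + d)) by ring.
    exact (is_curve_derive_mult _ _ _ _ _ F1 G1).
  - replace (Ci * _) with
      (Ci * (a - b) * g (x, y) + f (x, y) * (Ci * (c - d))) by ring.
    exact (is_curve_derive_mult _ _ _ _ _ F2 G2).
Qed.

(** * The Gaussian and its iterated Wirtinger derivatives *)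

Definition gauss (w : C) : C := Cexp (- (w * Cconj w)).

Lemma gauss_xy (x y : R) : gauss (x, y) = RtoC (exp (- (x * x + y * y))).
Proof.
  unfold gauss, Cexp; simpl.
  replace (- (x * - y + y * x))%R with 0%R by ring.
  rewrite cos_0, sin_0; apply injective_projections; simpl.
  - rewrite Rmult_1_r; f_equal; ring.
  - ring.
Qed.

Lemma Cexp_gauss (z : C) : Cexp (z * Cconj z) * gauss z = 1.
Proof.
  destruct z as [x y]; rewrite gauss_xy; unfold Cexp; simpl.
  replace (x * - y + y * x)%R with 0%R by ring.
  rewrite cos_0, sin_0.
  replace (x * x - y * - y)%R with (x * x + y * y)%R by ring.
  rewrite exp_Ropp; apply injective_projections; simpl; field;
    apply Rgt_not_eq, exp_pos.
Qed.

Lemma is_wirtinger_gauss (z : C) :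
  is_wirtinger gauss z (- (Cconj z * gauss z)) (- (z * gauss z)).
Proof.
  destruct z as [x y]; rewrite gauss_xy.
  (* The real form has no sine or cosine left to differentiate. *)
  replace gauss with
    (fun w : C => RtoC (exp (- (Re w * Re w + Im w * Im w))))
    by (apply functional_extensionality; intros [u v]; now rewrite gauss_xy).
  split; split; simpl; auto_derive; trivial; ring.
Qed.

(** Iterating [partial_z] uses the vanishing first value; the second is left existential. *)
Lemma is_wirtinger_conj_pow (q : nat) (z : C) :
  exists b, is_wirtinger (fun w => (Cconj w) ^ q) z 0 b.
Proof.
  induction q as [|q [b IH]].
  - exists 0; exact (is_wirtinger_const 1 z).
  - eexists; simpl.
    replace (RtoC 0) with (0 * (Cconj z) ^ q + Cconj z * 0) by ring.
    exact (is_wirtinger_mult _ _ _ _ _ _ _ (is_wirtinger_conj z) IH).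
Qed.

(** The derivative of [e^{v w}] in [w] is [v e^{v w}], and multiplication by [v] is [shift]. *)
Lemma is_wirtinger_exp_coeff (k : nat) (z : C) :
  is_wirtinger (fun w => exp_coeff (Cconj w) k) z 0
    (shift (exp_coeff (Cconj z)) k).
Proof.
  induction k as [|k IH].
  (* At index 0 the coefficient does not depend on its argument, so any argument names the
     constant. *)
  - exact (is_wirtinger_const (exp_coeff 0 0) z).
  - assert (HS : RtoC (INR (S k)) <> 0).
    { intros H; apply RtoC_inj in H; exact (not_0_INR _ (Nat.neq_succ_0 k) H). }
    assert (E : forall w, exp_coeff w (S k) =
              / RtoC (INR (S k)) * (w * exp_coeff w k)).
    { intros w; unfold exp_coeff; rewrite fact_simpl, mult_INR, RtoC_mult.
      simpl Cpow; field; split; [apply fact_C_neq_0 | exact HS]. }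
    replace (fun w => exp_coeff (Cconj w) (S k)) with
      (fun w => / RtoC (INR (S k)) * (Cconj w * exp_coeff (Cconj w) k))
      by (apply functional_extensionality; intros w; now rewrite E).
    pose proof (is_wirtinger_mult _ _ _ _ _ _ _
      (is_wirtinger_const (/ RtoC (INR (S k))) z)
      (is_wirtinger_mult _ _ _ _ _ _ _ (is_wirtinger_conj z) IH)) as W.
    cbv beta in W.
    match type of W with is_wirtinger _ _ ?a ?b =>
      replace (RtoC 0) with a by ring;
      replace (shift (exp_coeff (Cconj z)) (S k)) with b; [exact W|] end.
    simpl shift at 2.
    (* The product rule then gives [1 + k] copies of the coefficient, which cancel the factor
       [1 / (k + 1)]. *)
    assert (E' : Cconj z * shift (exp_coeff (Cconj z)) k =
                 RtoC (INR k) * exp_coeff (Cconj z) k).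
    { destruct k as [|k]; simpl shift; [simpl; ring|].
      unfold exp_coeff; rewrite fact_simpl, mult_INR, RtoC_mult; simpl Cpow.
      field; split; [apply fact_C_neq_0|].
      intros H; apply RtoC_inj in H; exact (not_0_INR _ (Nat.neq_succ_0 k) H). }
    rewrite E'; rewrite S_INR, RtoC_plus in *; field; exact HS.
Qed.

(** Since [(z - v)^p] is holomorphic in [z], the conjugate derivative acts only on the exponential
    and again multiplies by [v]. *)
Lemma is_wirtinger_hermite_coeff (p k : nat) (z : C) :
  exists a, is_wirtinger (fun w => hermite_coeff p w (Cconj w) k) z a
    (shift (hermite_coeff p z (Cconj z)) k).
Proof.
  revert k; induction p as [|p IH]; intros k.
  - exists 0; apply is_wirtinger_exp_coeff.
  - assert (S1 : exists a, is_wirtinger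
        (fun w => shift (hermite_coeff p w (Cconj w)) k) z a
        (shift (shift (hermite_coeff p z (Cconj z))) k)).
    { destruct k as [|k]; [exists 0; exact (is_wirtinger_const 0 z) | apply IH]. }
    destruct S1 as [a1 W1]; destruct (IH k) as [a2 W2].
    pose proof (is_wirtinger_minus _ _ _ _ _ _ _
      (is_wirtinger_mult _ _ _ _ _ _ _ (is_wirtinger_id z) W2) W1) as W.
    cbv beta in W; eexists.
    match type of W with is_wirtinger _ _ _ ?b =>
      replace (shift (hermite_coeff (S p) z (Cconj z)) k) with b;
      [exact W|] end.
    destruct k as [|k]; simpl; [|unfold mul_sub, hermite_coeff]; ring.
Qed.

(** Each [partial_z] falls on the Gaussian alone and brings down a factor [- Cconj z]. *)
Lemma iter_partial_z_gauss (q : nat) :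
  Nat.iter q partial_z gauss =
  fun z => RtoC (-1) ^ q * ((Cconj z) ^ q * gauss z).
Proof.
  induction q as [|q IH]; simpl; apply functional_extensionality; intros z.
  - ring.
  - rewrite IH; destruct (is_wirtinger_conj_pow q z) as [b Wb].
    pose proof (is_wirtinger_mult _ _ _ _ _ _ _
      (is_wirtinger_const (RtoC (-1) ^ q) z)
      (is_wirtinger_mult _ _ _ _ _ _ _ Wb (is_wirtinger_gauss z))) as W.
    rewrite (proj1 (is_wirtinger_partial _ _ _ _ W)).
    replace (RtoC (-1)) with (- RtoC 1) by (rewrite <- RtoC_opp; reflexivity).
    ring.
Qed.

(** The coefficient contributes its [shift] and the Gaussian a factor [- z]; together they form
    minus [mul_sub z], one more step of [hermite_coeff]. *)
Lemma iter_partial_zbar_gauss (p q : nat) :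
  Nat.iter p partial_zbar (Nat.iter q partial_z gauss) =
  fun z => RtoC (-1) ^ (p + q) * RtoC (INR (fact q)) *
    (hermite_coeff p z (Cconj z) q * gauss z).
Proof.
  induction p as [|p IH]; simpl; apply functional_extensionality; intros z.
  - rewrite iter_partial_z_gauss; unfold hermite_coeff, exp_coeff; simpl.
    field; apply fact_C_neq_0.
  - rewrite IH; destruct (is_wirtinger_hermite_coeff p q z) as [a Wa].
    pose proof (is_wirtinger_mult _ _ _ _ _ _ _
      (is_wirtinger_const (RtoC (-1) ^ (p + q) * RtoC (INR (fact q))) z)
      (is_wirtinger_mult _ _ _ _ _ _ _ Wa (is_wirtinger_gauss z))) as W.
    rewrite (proj2 (is_wirtinger_partial _ _ _ _ W)).
    change (hermite_coeff (S p) z (Cconj z) q) with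
      (mul_sub z (hermite_coeff p z (Cconj z)) q); unfold mul_sub.
    replace (RtoC (-1)) with (- RtoC 1) by (rewrite <- RtoC_opp; reflexivity).
    ring.
Qed.

(** * Passage to coefficients and the final identity *)

Lemma complexHermite_coeff (p q : nat) (z : C) :
  complexHermite p q z = RtoC (INR (fact q)) * hermite_coeff p z (Cconj z) q.
Proof.
  unfold complexHermite; fold gauss; rewrite iter_partial_zbar_gauss.
  assert (E : RtoC (-1) ^ (p + q) * RtoC (-1) ^ (p + q) = 1).
  { rewrite <- Cpow_mult_l, <- RtoC_mult.
    replace (-1 * -1)%R with 1%R by ring; apply Cpow_1_l. }
  set (e := RtoC (-1) ^ (p + q)) in *.
  transitivity (e * e * (Cexp (z * Cconj z) * gauss z) *
    (RtoC (INR (fact q)) * hermite_coeff p z (Cconj z) q)); [ring|].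
  rewrite E, Cexp_gauss; ring.
Qed.

Theorem proposition3p1 : forall (p s q : nat) (z : C),
  complexHermite (p + s) q z =
  RtoC (powerRZ (sqrt 2) (Z.of_nat p + Z.of_nat s - Z.of_nat q)) *
  RtoC (INR (fact q)) *
  sum_n (fun k : nat =>
    complexHermite s k (z / RtoC (sqrt 2)) / RtoC (INR (fact k)) *
    (complexHermite p (q - k) (z / RtoC (sqrt 2)) /
       RtoC (INR (fact (q - k))))) q.
Proof.
  intros p s q z.
  assert (Hr : sqrt 2 <> 0%R) by (apply Rgt_not_eq, sqrt_lt_R0; lra).
  assert (Hc : RtoC (sqrt 2) <> 0) by (intros H; now apply RtoC_inj in H).
  assert (Hconj : Cconj (z / RtoC (sqrt 2)) = Cconj z / RtoC (sqrt 2)).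
  { unfold Cdiv; rewrite Cmult_conj, <- RtoC_inv by exact Hr; f_equal.
    apply injective_projections; simpl; ring. }
  (* The 2 comes from adding the two exponents; the result has the form [r * w] of
     [hermite_coeff_scale] with [r = sqrt 2]. *)
  assert (H2 : RtoC 2 * (Cconj z / RtoC (sqrt 2)) = RtoC (sqrt 2) * Cconj z).
  { replace (RtoC 2) with (RtoC (sqrt 2) * RtoC (sqrt 2))
      by (rewrite <- RtoC_mult, sqrt_sqrt; [reflexivity | lra]).
    field; exact Hc. }
  rewrite (sum_n_C_ext _ (fun k =>
    hermite_coeff s (z / RtoC (sqrt 2)) (Cconj z / RtoC (sqrt 2)) k *
    hermite_coeff p (z / RtoC (sqrt 2)) (Cconj z / RtoC (sqrt 2)) (q - k)%nat)).
  2:{ intros k _; rewrite !complexHermite_coeff, Hconj.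
      field; split; apply fact_C_neq_0. }
  change (sum_n _ q) with
    (conv (hermite_coeff s (z / RtoC (sqrt 2)) (Cconj z / RtoC (sqrt 2)))
          (hermite_coeff p (z / RtoC (sqrt 2)) (Cconj z / RtoC (sqrt 2))) q).
  rewrite conv_hermite_coeff, H2, complexHermite_coeff.
  rewrite (hermite_coeff_scale _ _ (RtoC (sqrt 2))) by exact Hc.
  (* The integer exponent may be negative, so the power is split into [r^(p+s)] and the inverse of
     [r^q]. *)
  unfold Z.sub; rewrite <- Nat2Z.inj_add, powerRZ_add, powerRZ_neg' by exact Hr.
  rewrite <- !pow_powerRZ, RtoC_mult, RtoC_inv, !RtoC_pow by (apply pow_nonzero; exact Hr).
  unfold Cdiv; ring.
Qed.
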